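(* Let $n\geq 2$ and $i\geq 1$ be integers. Then \[\mathrm{dc}(\overrightarrow{C}_{n^2-n}[\overrightarrow{C}_n]^i)=\left\lceil \frac{n^2-n}{n^2-n-1}\,T_n(i)\right\rceil.\]
   Context: $\overrightarrow{C}_m$ is the directed cycle with vertex set $\mathbb{Z}_m$ and arcs $j\to j+1$. The lexicographic product $D[H]$ has vertex set $V(D)\times V(H)$, with an arc from $(u,a)$ to $(v,b)$ iff $uv\in A(D)$, or $u=v$ and $ab\in A(H)$; $D[H]^1=D[H]$ and $D[H]^i=(D[H]^{i-1})[H]$. The dichromatic number $\mathrm{dc}(D)$ is the smallest $k$ such that $V(D)$ can be partitioned into $k$ classes each inducing a subdigraph with no directed cycle. $T_n(0)=1$ and $T_n(i)=\lceil \tfrac{n}{n-1}T_n(i-1)\rceil$ for $i\geq 1$. *)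

(* Defs.v *)
From HB Require Import structures.
From mathcomp Require Import all_boot all_order all_algebra.

Set Implicit Arguments.
Unset Strict Implicit.
Unset Printing Implicit Defensive.

Import Order.TTheory GRing.Theory Num.Theory.

Record digraph := Digraph { vertex :> finType; arc : rel vertex }.

Arguments arc : clear implicits.

(* [ordS j] is j + 1 modulo m, so ['I_m] stands for Z_m, for every m >= 1. *)
Definition dicycle (m : nat) : digraph :=
  @Digraph 'I_m (fun j k => k == ordS j).

Definition lexprod (D H : digraph) : digraph :=
  @Digraph (vertex D * vertex H)%type
    (fun x y => arc D x.1 y.1 || (x.1 == y.1) && arc H x.2 y.2).

(* D[H]^i; the exponent 0 gives D, so that D[H]^1 = D[H]. *)
Fixpoint lexpow (D H : digraph) (i : nat) : digraph :=
  if i is i'.+1 then lexprod (lexpow D H i') H else D.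

Definition induced (D : digraph) (A : {set D}) : digraph :=
  @Digraph {x : D | x \in A} (fun x y => arc D (val x) (val y)).

(* A directed cycle has distinct vertices, so its length is at most #|D|;
   loops and digons count as directed cycles. *)
Definition acyclic (D : digraph) : bool :=
  ~~ [exists k : 'I_#|D|, exists c : k.+1.-tuple D, ucycleb (arc D) c].

Lemma acyclicP (D : digraph) :
  reflect (forall c : seq D, c != [::] -> ~ ucycle (arc D) c) (acyclic D).
Proof.
apply: (iffP idP) => [acD c c_n0 cyc_c | noc].
  have [_ uc] := andP cyc_c.
  case: c c_n0 cyc_c uc => // x c _ cyc_c uc.
  have lt_c : size c < #|D|.
    by rewrite -[(size c).+1]/(size (x :: c)) -(card_uniqP uc) max_card.
  case/negP: acD; apply/existsP; exists (Ordinal lt_c).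
  by apply/existsP; exists (in_tuple (x :: c)).
apply/negP => /existsP[k /existsP[c cyc_c]].
by apply: (noc c) cyc_c; rewrite -size_eq0 size_tuple.
Qed.

Definition acyclic_partition (D : digraph) (k : nat) : bool :=
  [exists P : {set {set D}},
    [&& partition P [set: D], #|P| == k
      & [forall A in P, acyclic (induced A)]]].

(* The least k; it is at most #|D| unless D has a loop, in which case no such k
   exists and the value is #|D|.+1. *)
Definition dc (D : digraph) : nat :=
  find (acyclic_partition D) (iota 0 #|D|.+1).

Lemma dcP (D : digraph) : irreflexive (arc D) ->
  acyclic_partition D (dc D) /\
  (forall k, acyclic_partition D k -> dc D <= k).
Proof.
move=> irrD.
have hasD : has (acyclic_partition D) (iota 0 #|D|.+1).
  apply/hasP; exists #|D|; first by rewrite mem_iota /= ltnS.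
  apply/existsP; exists (preim_partition id [set: D]).
  rewrite preim_partitionP /=; apply/andP; split.
    rewrite -cardsT; have /eqP <- : [set [set x] | x in [set: D]]
        == preim_partition id [set: D].
      apply/eqP/eq_imset => x; apply/setP => y.
      by rewrite !inE /= eq_sym.
    by rewrite card_imset //; exact: set1_inj.
  apply/forall_inP => A /imsetP[x _ defA]; apply/acyclicP => -[//|y c] _.
  have arcF (u v : induced A) : arc (induced A) u v = false.
    have inA (w : induced A) : val w = x.
      have: val w \in A := valP w.
      by move: (val w) => y'; rewrite defA !inE /= => /eqP.
    by rewrite /= !inA irrD.
  by case/andP; case: c => [|z c] /andP[]; rewrite arcF.
have lt_dc : dc D < #|D|.+1.
  by rewrite -[X in _ < X](size_iota 0) -has_find.
split; first by have := nth_find 0 hasD; rewrite nth_iota.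
move=> k Pk; rewrite leqNgt; apply/negP => lt_k.
have := before_find 0 lt_k.
by rewrite nth_iota ?Pk // (ltn_trans lt_k).
Qed.

Lemma dicycle_irr (m : nat) : 1 < m -> irreflexive (arc (dicycle m)).
Proof.
move=> m_gt1 j /=; apply/negP => /eqP/(congr1 val) /= Ej.
case: (ltnP j.+1 m) => [lt_j | le_m].
  by move: Ej; rewrite modn_small // => /n_Sn.
have Em : j.+1 = m by apply/eqP; rewrite eqn_leq le_m ltn_ord.
move: Ej; rewrite Em modnn => j0.
by move: Em; rewrite j0 => m1; rewrite -m1 in m_gt1.
Qed.

Lemma lexpow_irr (D H : digraph) (i : nat) :
  irreflexive (arc D) -> irreflexive (arc H) -> irreflexive (arc (lexpow D H i)).
Proof. by move=> irD irH; elim: i => //= i IHi x; rewrite IHi irH andbF. Qed.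

Local Open Scope ring_scope.

Fixpoint T (n i : nat) : int :=
  if i is i'.+1 then Num.ceil (n%:Q / (n%:Q - 1) * (T n i')%:Q) else 1.

(* Main.v *)
From mathcomp Require Import all_boot all_order all_algebra.
From mathcomp Require Import zify.
Require Import Defs.

(** Consider k-fold colorings: every vertex receives at least k colors, and each
    color class induces an acyclic subdigraph. In D[C_n] the union of the color
    sets over a fiber is a coloring of D. Each color used on a fiber misses one
    of its n vertices, so double counting gives n * k <= (n - 1) * s, where s is
    the number of colors used on the fiber; conversely s such colors can be spread
    evenly over the fiber. Hence k-fold colorings of D[C_n] correspond to
    ceil(n * k / (n - 1))-fold colorings of D, so that 1-fold colorings of
    C_m[C_n]^i correspond to T_n(i)-fold colorings of C_m, and C_m has a k-fold
    coloring with t colors iff m * k <= (m - 1) * t. *)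

(** * Acyclicity through rank functions *)

Definition ranked (D : digraph) (P : pred D) : Prop :=
  exists r : D -> nat, forall x y, P x -> P y -> arc D x y -> r x < r y.

(** Rank a vertex by the number of vertices that reach it. Along an arc from x to y the count grows
    strictly, since a path from y back to x would close a directed cycle. *)
Lemma acyclic_ranked (D : digraph) : acyclic D <-> ranked D xpredT.
Proof.
split=> [/acyclicP acD | [r rP]].
  exists (fun x => #|[pred y | connect (arc D) y x]|) => x y _ _ xy.
  apply: proper_card; apply/properP; split.
    by apply/subsetP => z; rewrite !inE => /connect_trans; apply; apply: connect1.
  exists y; rewrite !inE ?connect0 //; apply/negP => /connectP[p0 pth0 ex].
  case/shortenP: pth0 ex => p pth up _ ex.
  by apply: (acD (y :: p)) => //; rewrite /ucycle /= rcons_path pth -ex xy.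
apply/acyclicP => -[//|x c] _ /andP[/= cyc _].
have cyc_r : path ltn (r x) (map r (rcons c x)).
  by rewrite path_map; apply: sub_path cyc => u v /= uv; apply: rP.
have := order_path_min ltn_trans cyc_r.
by rewrite map_rcons all_rcons ltnn.
Qed.

Lemma acyclic_induced (D : digraph) (A : {set D}) :
  acyclic (induced A) <-> ranked D (fun x => x \in A).
Proof.
rewrite acyclic_ranked; split=> -[r rP].
  exists (fun x => if insub x is Some u then r u else 0) => x y Ax Ay xy.
  by rewrite !insubT; apply: rP.
by exists (fun u => r (val u)) => x y _ _ xy; apply: rP xy; apply: valP.
Qed.

(** * Multiple colorings and the dichromatic number *)

Definition kfold (D : digraph) (k t : nat) : Prop :=
  exists f : D -> {set 'I_t},
    (forall v, k <= #|f v|) /\ (forall c, ranked D (fun v => c \in f v)).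

(** The index of its block colors each vertex; conversely, choosing one color from each set gives at
    most [t] acyclic classes. Without loops [dc] is an attained minimum, not its default value. *)
Lemma dc_leq (D : digraph) (t : nat) :
  irreflexive (arc D) -> dc D <= t <-> kfold D 1 t.
Proof.
move=> /dcP[dcD dc_min]; split=> [le_t | [f [f_gt0 fP]]].
  case/existsP: dcD => P /and3P[partP /eqP cardP /forall_inP acP].
  have covP x : x \in cover P by rewrite (cover_partition partP) inE.
  have PP x : pblock P x \in P by apply: pblock_mem.
  have lt_t x : index (pblock P x) (enum P) < t.
    by apply: leq_trans le_t; rewrite -cardP cardE index_mem mem_enum.
  exists (fun x => [set Ordinal (lt_t x)]); split=> [v|c]; first by rewrite cards1.
  have [/existsP[x /eqP Ec] | noc] := boolP [exists x, c == Ordinal (lt_t x)].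
    have /acyclic_induced[r rP] := acP _ (PP x); exists r => y z.
    have inx w : c \in [set Ordinal (lt_t w)] -> w \in pblock P x.
      rewrite inE Ec => /eqP[] /(congr1 (nth set0 (enum P))).
      by rewrite !nth_index ?mem_enum // => ->; rewrite mem_pblock.
    by move=> /inx yx /inx zx; apply: rP.
  exists (fun=> 0) => x y; rewrite inE => /eqP Ec.
  by case/existsP: noc; exists x; apply/eqP.
have exf v : exists c, c \in f v by apply/set0Pn; rewrite -card_gt0.
pose g v := xchoose (exf v); have gP v : g v \in f v by apply: xchooseP.
pose P := preim_partition g [set: D].
apply: (@leq_trans #|P|).
  apply: dc_min; apply/existsP; exists P; rewrite preim_partitionP eqxx /=.
  apply/forall_inP => A /imsetP[x _ ->]; apply/acyclic_induced.
  have [r rP] := fP (g x); exists r => y z.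
  rewrite !inE /= => /eqP Ey /eqP Ez; apply: rP; first by rewrite Ey.
  by rewrite Ez.
pose h c := [set y | c == g y].
have -> : P = [set h c | c in [set g x | x in [set: D]]].
  rewrite -imset_comp; apply: eq_imset => x /=; apply/setP => y.
  by rewrite !inE.
by rewrite (leq_trans (leq_imset_card _ _)) // (leq_trans (max_card _)) ?card_ord.
Qed.

(** * Colorings of directed cycles *)

Lemma sum_missing_leq (m k : nat) (C : finType) (f : 'I_m -> {set C})
    (G : {set C}) :
  (forall a, f a \subset G) -> (forall a, k <= #|f a|) ->
  (forall c, exists a, c \notin f a) -> m * k <= m.-1 * #|G|.
Proof.
move=> fG kf missf.
have -> : m * k = \sum_(a < m) k by rewrite sum_nat_const card_ord.
apply: leq_trans (_ : \sum_(a < m) #|f a| <= _).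
  by apply: leq_sum => a _; apply: kf.
have -> : \sum_(a < m) #|f a| = \sum_(a < m) \sum_(c in G) (c \in f a).
  apply: eq_bigr => a _; rewrite -sum1_card [RHS]big_mkcond [LHS]big_mkcond /=.
  apply: eq_bigr => c _; have := subsetP (fG a) c.
  by case: (c \in f a); case: (c \in G) => // /(_ isT).
rewrite exchange_big /= mulnC -sum_nat_const; apply: leq_sum => c _.
have [a0 a0P] := missf c.
rewrite (bigD1 a0) //= (negbTE a0P) add0n.
apply: leq_trans (_ : \sum_(a < m | a != a0) 1 <= _).
  by apply: leq_sum => a _; case: (_ \in _).
by rewrite sum1_card cardC1 card_ord.
Qed.

(* The color of index j in [enum G] is omitted exactly at the vertex j mod m. *)
Definition spread (m : nat) (C : finType) (G : {set C}) (a : 'I_m) : {set C} :=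
  [set c in G | index c (enum G) %% m != a].

Lemma card_spread (m k : nat) (C : finType) (G : {set C}) (a : 'I_m) :
  m * k <= m.-1 * #|G| -> k <= #|spread m C G a|.
Proof.
move=> le_mk; pose B := [set c in G | index c (enum G) %% m == a].
have m_gt0 : 0 < m := leq_ltn_trans (leq0n a) (ltn_ord a).
have EG : #|spread m C G a| + #|B| = #|G|.
  rewrite -(cardsID B G) addnC; congr (_ + _); apply: eq_card => c.
    by rewrite !inE; case: (c \in G).
  by rewrite !inE; case: (c \in G); rewrite ?andbT ?andbF.
(* [B] holds the colors omitted at [a]. Their indices are [q * m + a] with distinct quotients [q],
   all below [#|G| - k] because [#|G| <= (#|G| - k) * m]. *)
suff leB : #|B| <= #|G| - k by nia.
pose q c := index c (enum G) %/ m.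
have idx c : c \in B -> index c (enum G) = q c * m + a.
  by rewrite inE => /andP[_ /eqP <-]; rewrite /q -divn_eq.
have -> : #|B| = size (map q (enum B)) by rewrite size_map -cardE.
rewrite -[X in _ <= X](size_iota 0); apply: uniq_leq_size.
  rewrite map_inj_in_uniq ?enum_uniq // => x y.
  rewrite !mem_enum => xB yB qxy.
  have: nth x (enum G) (index x (enum G)) = nth x (enum G) (index y (enum G)).
    by rewrite (idx x) // (idx y) // qxy.
  move: xB yB; rewrite !inE => /andP[xG _] /andP[yG _].
  by rewrite !nth_index ?mem_enum.
move=> j /mapP[c]; rewrite mem_enum inE => /andP[cG _] ->.
rewrite mem_iota /= add0n /q ltn_divLR //.
apply: leq_trans (_ : #|G| <= _); first by rewrite cardE index_mem mem_enum.
nia.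
Qed.

Lemma dicycle_rank_miss (m : nat) (P : pred 'I_m) (r : 'I_m -> nat) : 0 < m ->
  (forall a b, P a -> P b -> arc (dicycle m) a b -> r a < r b) ->
  exists a, ~~ P a.
Proof.
move=> m_gt0 rP; apply/existsP; rewrite -negb_forall; apply/negP => /forallP PT.
(* If [P] held everywhere, the rank would grow on every arc; summing around the cycle gives a total
   exceeding itself by [m]. *)
have: \sum_(a < m) (r a).+1 <= \sum_(a < m) r (ordS a).
  by apply: leq_sum => a _; apply: rP => //=.
have <- : \sum_(a < m) r a = \sum_(a < m) r (ordS a).
  exact: reindex_inj (@ordS_inj m).
under eq_bigr do rewrite -addn1.
by rewrite big_split /= sum_nat_const card_ord muln1; lia.
Qed.

(** The rank is the distance along the cycle from [b0]; it drops only on the arc entering [b0]. *)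
Lemma dicycle_rank (m : nat) (b0 : nat) (a b : 'I_m) : b0 < m ->
  a != b0 :> nat -> b != b0 :> nat -> arc (dicycle m) a b ->
  (a + (m - b0)) %% m < (b + (m - b0)) %% m.
Proof.
move=> lt_b0 ab0 bb0 /= /eqP Eb.
have {}Eb : (b : nat) = if a.+1 == m then 0 else a.+1.
  rewrite Eb /=; case: eqVneq => [->|ne_m]; first by rewrite modnn.
  by rewrite modn_small //; have := ltn_ord a; lia.
have := ltn_ord a; have := ltn_ord b => ltb lta.
have modE x : x < m -> (x + (m - b0)) %% m = if x < b0 then x + (m - b0) else x - b0.
  move=> lt_xm; case: (ltnP x b0) => [lt_x | ge_x]; first by rewrite modn_small //; lia.
  have -> : x + (m - b0) = (x - b0) + m by lia.
  by rewrite modnDr modn_small //; lia.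
rewrite !modE //; move: Eb.
by case: (eqVneq a.+1 m); case: (ltnP a b0); case: (ltnP b b0); lia.
Qed.

(** The bound [r a < m] lets these ranks serve as the low digit of a lexicographic rank on a
    product. *)
Lemma spread_ranked (m : nat) (C : finType) (G : {set C}) (c : C) : 0 < m ->
  exists r : 'I_m -> nat, (forall a, r a < m) /\
    forall a b, c \in spread m C G a -> c \in spread m C G b ->
      arc (dicycle m) a b -> r a < r b.
Proof.
move=> m_gt0; pose b0 := index c (enum G) %% m.
exists (fun a => (a + (m - b0)) %% m); split=> [a|a b]; first by rewrite ltn_pmod.
rewrite !inE => /andP[_ ab0] /andP[_ bb0]; apply: dicycle_rank.
- by rewrite ltn_pmod.
- by rewrite eq_sym.
- by rewrite eq_sym.
Qed.

Lemma kfold_dicycle (m k t : nat) : 0 < m ->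
  kfold (dicycle m) k t <-> m * k <= m.-1 * t.
Proof.
move=> m_gt0; split=> [[f [kf fP]] | le_mk].
  rewrite -[X in _ <= _ * X](card_ord t) -cardsT.
  apply: sum_missing_leq kf _ => [a|c]; first exact: subsetT.
  by have [r rP] := fP c; apply: dicycle_rank_miss m_gt0 rP.
exists (spread m 'I_t [set: _]); split=> [a|c].
  by apply: card_spread; rewrite cardsT card_ord.
by have [r [_ rP]] := spread_ranked m 'I_t [set: _] c m_gt0; exists r.
Qed.

(** * Colorings of lexicographic products *)

(** For [m > 1] this is m * k / (m - 1) rounded up. *)
Definition ceil_step (m k : nat) : nat := (m * k + m.-2) %/ m.-1.

Lemma ceil_step_leq (m k s : nat) : 1 < m ->
  (ceil_step m k <= s) = (m * k <= m.-1 * s).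
Proof.
move=> m_gt1; rewrite /ceil_step -ltnS ltn_divLR; last by lia.
by apply/idP/idP; nia.
Qed.

Lemma kfold_lexprod (D : digraph) (n k t : nat) : 1 < n ->
  kfold (lexprod D (dicycle n)) k t <-> kfold D (ceil_step n k) t.
Proof.
move=> n_gt1; have n_gt0 := ltnW n_gt1; split=> [[f [kf fP]] | [g [kg gP]]].
  exists (fun u => \bigcup_(a < n) f (u, a)); split=> [u|c].
    rewrite ceil_step_leq //; apply: (@sum_missing_leq _ _ _ (fun a => f (u, a))).
    - by move=> a; apply: bigcup_sup.
    - by move=> a; apply: kf.
    move=> c; have [r rP] := fP c.
    apply: (@dicycle_rank_miss _ _ (fun a => r (u, a))) => // a b Pa Pb ab.
    by apply: rP => //; apply/orP; right; rewrite /= eqxx.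
  have [r rP] := fP c.
  (* The maximum over the fiber is attained at a vertex of color [c], which has arcs to the whole
     fiber over [v]. *)
  exists (fun u => \max_(a < n | c \in f (u, a)) r (u, a)).
  move=> u v /bigcupP[a _ cua] /bigcupP[b _ cvb] uv.
  apply: (@leq_trans (r (v, b))); last first.
    exact: (@leq_bigmax_cond _ (fun b => c \in f (v, b)) (fun b => r (v, b))).
  rewrite (bigmax_eq_arg a) //.
  by case: arg_maxnP => // a' ca' _; apply: rP => //=; rewrite uv.
exists (fun x : lexprod D (dicycle n) => spread n _ (g x.1) x.2).
split=> [x|c]; first by apply: card_spread; rewrite -ceil_step_leq.
have [r rP] := gP c.
have [rho rhoP] := fin_all_exists (fun u => spread_ranked n _ (g u) c n_gt0).
(* Lexicographic rank: first the rank in [D], then the position in the fiber, which is below [n]. *)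
exists (fun x : lexprod D (dicycle n) => r x.1 * n + rho x.1 x.2).
move=> [u a] [v b] /= ca cb /orP[uv | /andP[/eqP Euv ab]].
  have [cu cv] : c \in g u /\ c \in g v.
    by move: ca cb; rewrite !inE => /andP[-> _] /andP[-> _].
  have := rP u v cu cv uv; have := (rhoP u).1 a; nia.
by subst v; rewrite ltn_add2l; apply: (rhoP u).2.
Qed.

Lemma kfold_lexpow (D : digraph) (n i k t : nat) : 1 < n ->
  kfold (lexpow D (dicycle n) i) k t <-> kfold D (iter i (ceil_step n) k) t.
Proof.
move=> n_gt1; elim: i k => [|i IHi] k //=.
by rewrite kfold_lexprod // IHi -iterSr.
Qed.

Lemma dc_lexpow_dicycle (m n i : nat) : 1 < m -> 1 < n ->
  dc (lexpow (dicycle m) (dicycle n) i) =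
  ceil_step m (iter i (ceil_step n) 1).
Proof.
move=> m_gt1 n_gt1.
have dcE t : dc (lexpow (dicycle m) (dicycle n) i) <= t <->
    ceil_step m (iter i (ceil_step n) 1) <= t.
  rewrite dc_leq; last by apply: lexpow_irr; apply: dicycle_irr.
  by rewrite kfold_lexpow // kfold_dicycle ?ceil_step_leq // ltnW.
by apply/eqP; rewrite eqn_leq; apply/andP; split; apply/dcE.
Qed.

(** * Passage to rational ceilings *)

Import Order.TTheory GRing.Theory Num.Theory.
Local Open Scope ring_scope.

Lemma ceil_stepE (m k : nat) : (1 < m)%N ->
  (ceil_step m k)%:Z = Num.ceil (m%:Q / (m%:Q - 1) * k%:Q).
Proof.
move=> m_gt1; apply/esym/ceil_def.
have m1_gt0 : 0 < m%:Q - 1 by rewrite subr_gt0 (ltr_int _ 1 m).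
have m1E : m%:Q - 1 = (m.-1)%:Q by rewrite predn_int ?intrB // ltnW.
rewrite mulrAC ler_pdivrMr // ltr_pdivlMr // m1E.
rewrite -!intrM ltr_int ler_int.
have := ceil_step_leq m k (ceil_step m k) m_gt1; rewrite leqnn => le_s.
(* Minimality of [ceil_step m k] gives the strict lower bound; zero is set apart because [.-1]
   truncates there. *)
have lt_s : (0 < ceil_step m k)%N -> (m.-1 * (ceil_step m k).-1 < m * k)%N.
  by move=> s_gt0; rewrite ltnNge -ceil_step_leq // -ltnNge prednK.
move: lt_s le_s; move: (ceil_step m k) => s; case: s => [|s] /=; nia.
Qed.

Lemma T_iter (n i : nat) : (1 < n)%N -> T n i = (iter i (ceil_step n) 1%N)%:Z.
Proof. by move=> n_gt1; elim: i => //= i ->; rewrite ceil_stepE. Qed.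

Theorem theorem18 (n i : nat) (hn : (2 <= n)%N) (hi : (1 <= i)%N) :
  (dc (lexpow (dicycle (n ^ 2 - n)) (dicycle n) i))%:Z =
  Num.ceil ((n%:Q ^+ 2 - n%:Q) / (n%:Q ^+ 2 - n%:Q - 1) * (T n i)%:Q).
Proof.
have m_gt1 : (1 < n ^ 2 - n)%N by rewrite -mulnn; nia.
(* This makes the truncated subtraction of naturals agree with the rational one. *)
have le_n : (n <= n ^ 2)%N by rewrite -mulnn; nia.
have mE : n%:Q ^+ 2 - n%:Q = (n ^ 2 - n)%N%:Q.
  by rewrite -subzn // intrB -!pmulrn natrX.
by rewrite dc_lexpow_dicycle // T_iter // mE ceil_stepE.
Qed.
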